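(* Let $f(x)$ be the affine fractal function defined by a system $\mathcal{S}=\{S_1,\dots,S_m\}$ on the segment $[a,b]$. If the projected system $\mathcal{S}^\diamond=\{S_1^\diamond,\dots,S_m^\diamond\}$ does not satisfy the weak separation property, then the graph $\Gamma(f)$ is a segment of a parabola.
   Context: Affine fractal functions. Let $\mathcal{S}=\{S_1,\dots,S_m\}$ be a system of affine maps of $\mathbb{R}^2$ of the form $S_i(x,y)=(p_ix+h_i,\ q_iy+r_ix+s_i)$ with real coefficients, $|p_i|,|q_i|<1$ and $p_i,q_i\neq 0$. A function $f:[a,b]\to\mathbb{R}$ is the affine fractal function on $[a,b]$ defined by $\mathcal{S}$ if its graph $\Gamma(f)=\{(x,f(x)):x\in[a,b]\}$ is the attractor of $\mathcal{S}$, i.e. the unique nonempty compact set with $\Gamma(f)=\bigcup_{i=1}^m S_i(\Gamma(f))$. The pieces $S_i(\Gamma(f))$ are allowed to overlap. Projections and semigroups. Put $S_i^\diamond(x)=p_ix+h_i$ (an affine map of $\mathbb{R}$) and $\mathcal{S}^\diamond=\{S_1^\diamond,\dots,S_m^\diamond\}$. Let $G$ be the semigroup (under composition) generated by $\mathcal{S}$ and $G^\diamond$ the semigroup generated by $\mathcal{S}^\diamond$. Associated families. $\mathcal{F}=G^{-1}\circ G=\{g_1^{-1}g_2: g_1,g_2\in G\}$ and $\mathcal{F}^\diamond=(G^\diamond)^{-1}\circ G^\diamond=\{u_1^{-1}u_2:u_1,u_2\in G^\diamond\}$. Weak separation property (WSP). $\mathcal{S}$ satisfies WSP if the identity $\mathrm{Id}$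 is an isolated point of the associated family $\mathcal{F}$, i.e. there is no sequence in $\mathcal{F}\setminus\{\mathrm{Id}\}$ converging to $\mathrm{Id}$ (convergence of affine maps means convergence of their coefficients). Likewise $\mathcal{S}^\diamond$ satisfies WSP if $\mathrm{Id}$ is an isolated point of $\mathcal{F}^\diamond$.
   Formalization: ''Segment of a parabola'' is taken to include a straight line segment (zero leading coefficient), since f = 0 with maps (x/2, y/2), (x/2+1/2, y/2), (x/3, y/2) on [0,1] meets every hypothesis and has a straight graph. *)

(* Defs.v *)
From mathcomp Require Import all_boot all_order all_algebra.
From mathcomp Require Import all_classical all_reals all_analysis.

Set Implicit Arguments.
Unset Strict Implicit.
Unset Printing Implicit Defensive.

Import Order.TTheory GRing.Theory Num.Theory.
Import numFieldNormedType.Exports.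

Local Open Scope classical_set_scope.
Local Open Scope ring_scope.

(* Coefficients of (x, y) |-> (p x + h, q y + r x + s). *)
Record skew_affine (R : realType) := SkewAffine {
  sa_p : R; sa_h : R; sa_q : R; sa_r : R; sa_s : R }.

Definition skew_map (R : realType) (A : skew_affine R) (z : R * R) : R * R :=
  (sa_p A * z.1 + sa_h A, sa_q A * z.2 + sa_r A * z.1 + sa_s A).

Definition admissible (R : realType) (A : skew_affine R) : Prop :=
  [/\ sa_p A != 0, `|sa_p A| < 1, sa_q A != 0 & `|sa_q A| < 1].

Definition is_attractor (T : topologicalType) (I : Type) (S : I -> T -> T)
    (K : set T) : Prop :=
  let self_similar L :=
    [/\ L !=set0, compact L & L = \bigcup_(i in [set: I]) (S i @` L)] in
  self_similar K /\ forall L, self_similar L -> L = K.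

(* f is a total function; only its values on [a, b] matter. *)
Definition graph_on (R : realType) (a b : R) (f : R -> R) : set (R * R) :=
  [set z | a <= z.1 <= b /\ z.2 = f z.1].

Definition affine_fractal_function (R : realType) (m : nat)
    (S : 'I_m -> skew_affine R) (a b : R) (f : R -> R) : Prop :=
  (forall i, admissible (S i)) /\
  is_attractor (fun i => skew_map (S i)) (graph_on a b f).

(* Closed under composition only: the identity is not thrown in. *)
Inductive semigroup_gen (T I : Type) (S : I -> T -> T) : (T -> T) -> Prop :=
| semigroup_gen_base i : semigroup_gen S (S i)
| semigroup_gen_comp g h :
    semigroup_gen S g -> semigroup_gen S h -> semigroup_gen S (g \o h).

(* The set of all u1^-1 \o u2 with u1, u2 in G; v is the inverse of u1. *)
Definition associated_family (T : Type) (G : set (T -> T)) : set (T -> T) :=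
  [set g | exists u1 u2 v : T -> T,
     [/\ G u1, G u2, cancel u1 v, cancel v u1 & g = v \o u2]].

Definition line_map (R : realType) (c : R * R) (x : R) : R := c.1 * x + c.2.

Definition projection (R : realType) (A : skew_affine R) : R -> R :=
  line_map (sa_p A, sa_h A).

(* An affine map of the line is identified with its coefficient pair, so that
   convergence of maps is convergence in R * R; the identity is (1, 0). *)
Definition line_wsp (R : realType) (I : Type) (S : I -> R -> R) : Prop :=
  isolated [set c : R * R |
              associated_family (semigroup_gen S) (line_map c)] (1, 0).

(* The leading coefficient k may vanish: line segments count as degenerate
   parabola segments (they do occur, e.g. for f = 0). *)
Definition parabola_segment (R : realType) (K : set (R * R)) : Prop :=
  exists c d k l n : R,
    c < d /\ K = graph_on c d (fun x => k * x ^+ 2 + l * x + n).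

(* Main.v *)
(* Elements of the projected associated family near the identity lift to
   maps (x, y) |-> (p x + h, q y + r x + s) preserving the graph as long as
   abscissas stay in [a, b].  Conjugating such a lift T by S_i keeps p and q, so
   S_i^-1 T S_i T^-1 projects to a translation by tau_i and has q = 1:
   f (z + tau_i) - f z is affine in z.  If all tau_i vanished, the projected maps
   would share a fixed point, which is impossible for the segment [a, b].
   Without WSP one gets arbitrarily small nonzero tau; iterating and passing to
   the limit, f (z + d) - f z is affine in z for every d.  Then
   f (s + t) - f s - f t is bilinear up to constants, so f minus a quadratic is a
   continuous solution of Cauchy's equation on a segment, hence affine. *)
Require Import Defs.
From mathcomp Require Import all_boot all_order all_algebra.
From mathcomp Require Import all_classical all_reals all_analysis.
From mathcomp Require Import ring lra.
Set Implicit Arguments.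
Unset Strict Implicit.
Unset Printing Implicit Defensive.
Import Order.TTheory GRing.Theory Num.Theory.
Import numFieldNormedType.Exports.
Local Open Scope classical_set_scope.
Local Open Scope ring_scope.

(** * Continuity of a function with compact graph *)

(** Retraction of the line onto [[a, b]]: [f] is arbitrary outside the segment, while
    [f \o clamp a b] can be continuous everywhere. *)
Definition clamp (R : realType) (a b x : R) : R := Num.max a (Num.min b x).

Lemma clamp_id (R : realType) (a b x : R) : a <= x <= b -> clamp a b x = x.
Proof. by rewrite /clamp => /andP[ax xb]; rewrite (min_r xb) (max_r ax). Qed.

Lemma clamp_itv (R : realType) (a b x : R) : a <= b -> a <= clamp a b x <= b.
Proof. by move=> ab; rewrite /clamp le_max lexx ge_max ab ge_min lexx. Qed.

Lemma clamp_continuous (R : realType) (a b : R) : continuous (clamp a b).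
Proof.
move=> x; rewrite /clamp.
apply: continuous_max; first exact: cvg_cst.
by apply: continuous_min; [exact: cvg_cst | exact: cvg_id].
Qed.

(** At a discontinuity, the points [y] near [x] whose values stay [e] away form a proper filter. Its
    image in the compact graph clusters at a point of abscissa [clamp a b x], whose ordinate is then
    forced, contradicting the gap [e]. *)
Lemma compact_graph_continuous (R : realType) (a b : R) (f : R -> R) :
  a <= b -> compact (graph_on a b f) -> continuous (f \o clamp a b).
Proof.
move=> ab cG x.
pose h y := (clamp a b y, f (clamp a b y)).
have hG y : graph_on a b f (h y) by split => //=; exact: clamp_itv.
have fst_cts : continuous (@fst R R) by case=> u v; exact: cvg_fst.
apply/cvgrPdist_lt => e e0; rewrite near_simpl /=.
apply: contrapT => nV.
pose B := [set y | e <= `|f (clamp a b x) - f (clamp a b y)|].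
pose F := within B (nbhs x).
have PF : ProperFilter F.
  apply: Build_ProperFilter => //.
  have -> : F set0 = nbhs x (fun y => B y -> False) by [].
  move=> H; apply: nV.
  by apply: filterS H => y /= By; rewrite ltNge; apply/negP.
have PhF : ProperFilter (h @ F) by exact: fmap_proper_filter.
have [|[z1 z2] [[/= zab z2E] clz]] := cG (h @ F) PhF.
  suff : \forall y \near x, B y -> graph_on a b f (h y) by [].
  by near=> y.
have z1E : z1 = clamp a b x.
  apply: (@norm_hausdorff R R^o) => U V z1U V2.
  have hV : (h @ F) (fst @^-1` V).
    suff : nbhs x (fun y => B y -> (clamp a b @^-1` V) y) by [].
    have : nbhs x (clamp a b @^-1` V) by exact: clamp_continuous.
    by apply: filterS => y /= Vy _.
  have [q [qV qU]] := clz _ _ hV (fst_cts (z1, z2) _ z1U).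
  by exists q.1.
have hB : (h @ F) [set q | e <= `|f (clamp a b x) - q.2|].
  suff : \forall y \near x, B y -> B y by [].
  by near=> y.
have zB : nbhs (z1, z2) [set q : R * R | `|z2 - q.2| < e].
  have snd_cts : (@snd R R) @ nbhs (z1, z2) --> z2 by exact: cvg_snd.
  by move/cvgrPdist_lt: snd_cts; apply.
have [q [/= q1 q2]] := clz _ _ hB zB.
rewrite -z1E -z2E in q1.
by move: (lt_le_trans q2 q1); rewrite ltxx.
Unshelve. all: by end_near.
Qed.

(** * Limits of zeros, and additive functions on a segment *)

Lemma eq0_approx (R : realType) (F : R -> R) (d : R) :
  {for d, continuous F} ->
  (forall e, 0 < e -> exists2 d', `|d - d'| < e & F d' = 0) -> F d = 0.
Proof.
move=> cF H; apply/eqP; apply: contrapT => /negP Fd0.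
have Fd : 0 < `|F d| by rewrite normr_gt0.
move/cvgrPdist_lt : cF => /(_ _ Fd) /nbhs_ballP[e /= e0 He].
have [d' /He/= + Fd'] := H _ e0.
by rewrite Fd' subr0 ltxx.
Qed.

(* At [h = max h], doubling the argument (after reflecting it through
   [h (L - x) = - h x] when [x] lies in the right half) doubles the value. *)
Lemma additive_itv_le0 (R : realType) (L : R) (h : R -> R) :
  0 <= L -> {within `[0, L], continuous h} -> h L = 0 ->
  (forall x y, 0 <= x -> 0 <= y -> x + y <= L -> h (x + y) = h x + h y) ->
  forall x, 0 <= x <= L -> h x <= 0.
Proof.
move=> L0 ch hL hD x xL.
have [c] := EVT_max L0 ch.
rewrite in_itv /= => /andP[c0 cL] hmax.
have {}hmax t : 0 <= t <= L -> h t <= h c by move=> tL; apply: hmax; rewrite in_itv.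
apply: le_trans (hmax _ xL) _.
have [c2|c2] := leP (c + c) L.
  have := hmax (c + c); rewrite hD // => H.
  have /H : 0 <= c + c <= L by rewrite c2 addr_ge0.
  lra.
have hr : h (L - c) = - h c.
  have e : c + (L - c) = L by ring.
  have := hD c (L - c); rewrite e hL => H.
  by have := H c0 ltac:(lra) ltac:(lra); lra.
pose t := (L - c) + (L - c).
have ht : h t = - h c - h c by rewrite /t hD ?hr //; lra.
have hLt : h (L - t) = h c + h c.
  have e : t + (L - t) = L by ring.
  have := hD t (L - t); rewrite e hL ht => H.
  by have := H ltac:(rewrite /t; lra) ltac:(rewrite /t; lra) ltac:(lra); lra.
have := hmax (L - t); rewrite hLt => H.
have /H : 0 <= L - t <= L by rewrite /t; lra.
lra.
Qed.

Lemma additive_itv_eq0 (R : realType) (L : R) (h : R -> R) :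
  0 <= L -> {within `[0, L], continuous h} -> h L = 0 ->
  (forall x y, 0 <= x -> 0 <= y -> x + y <= L -> h (x + y) = h x + h y) ->
  forall x, 0 <= x <= L -> h x = 0.
Proof.
move=> L0 ch hL hD x xL; apply/eqP; rewrite eq_le; apply/andP; split.
  exact: (additive_itv_le0 L0 ch hL hD).
rewrite -oppr_le0.
apply: (@additive_itv_le0 _ L (fun y => - h y)) => //.
- by move=> y; apply: continuousN; exact: ch.
- by rewrite hL oppr0.
- by move=> u v u0 v0 uv; rewrite hD // opprD.
Qed.

(** * Functions with affine differences *)

(** The hypothesis is collinearity of three values of [g (_ + d) - g _], free of denominators. It
    makes the Cauchy defect [B] proportional to each argument, so [B s t = K * s * t], which is also
    the defect of [K / 2 * t ^+ 2]. *)
Lemma quadratic_of_affine_differences (R : realType) (a b : R) (g : R -> R) :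
  a < b -> continuous g ->
  (forall x y z d, 0 <= d -> a <= x -> a <= y -> a <= z ->
     x + d <= b -> y + d <= b -> z + d <= b ->
     (z - x) * (g (y + d) - g y) =
     (z - y) * (g (x + d) - g x) + (y - x) * (g (z + d) - g z)) ->
  exists k l n : R, forall x, a <= x <= b -> g x = k * x ^+ 2 + l * x + n.
Proof.
move=> ab cg gA.
pose L := b - a; pose G t := g (a + t) - g a.
have L0 : 0 < L by rewrite subr_gt0.
pose B s t := G (s + t) - G s - G t.
have BC s t : B s t = B t s by rewrite /B (addrC s); ring.
have BA s t u : 0 <= s -> 0 <= t -> 0 <= u -> s + t <= L -> u + t <= L ->
    u * B s t = s * B u t.
  move=> s0 t0 u0 st ut.
  have := gA a (a + s) (a + u) t t0; rewrite /B /G !addrA /L in st ut *.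
  move=> H; have {}H := H ltac:(lra) ltac:(lra) ltac:(lra) ltac:(lra) ltac:(lra) ltac:(lra).
  lra.
(* The midpoint can serve as reference in one argument as long as the other is at most [L / 2];
   symmetry of [B] covers the remaining case. *)
pose K := B (L / 2) (L / 2) / (L / 2) ^+ 2.
have BK' s t : 0 <= s -> 0 <= t -> t <= L / 2 -> s + t <= L ->
    B s t = K * s * t.
  move=> s0 t0 tL st.
  have e1 := BA s t (L / 2) s0 t0 ltac:(lra) st ltac:(lra).
  have e2 := BA t (L / 2) (L / 2) t0 ltac:(lra) ltac:(lra) ltac:(lra) ltac:(lra).
  rewrite (BC (L / 2) t) in e1.
  have L2 : L / 2 != 0 by lra.
  apply: (mulfI L2); apply: (mulfI L2); rewrite e1.
  rewrite mulrCA e2 /K; field; lra.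
have BK s t : 0 <= s -> 0 <= t -> s + t <= L -> B s t = K * s * t.
  move=> s0 t0 st; have [tL|tL] := leP t (L / 2); first exact: BK'.
  rewrite BC BK' //; first by ring.
  - lra.
  - lra.
(* This slope makes [h L = 0], so the additive remainder [h] vanishes. *)
pose l := (G L - K / 2 * L ^+ 2) / L.
pose h t := G t - K / 2 * t ^+ 2 - l * t.
have h0 : forall t, 0 <= t <= L -> h t = 0.
  apply: additive_itv_eq0.
  - exact: ltW.
  - apply: continuous_subspaceT => t.
    apply: cvgB; last by apply: cvgM; [exact: cvg_cst|exact: cvg_id].
    apply: cvgB; last by apply: cvgM; [exact: cvg_cst|exact: exprn_continuous].
    apply: cvgB; last exact: cvg_cst.
    apply: (@continuous_comp _ _ _ (fun t => a + t) g); last exact: cg.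
    by apply: cvgD; [exact: cvg_cst|exact: cvg_id].
  - by rewrite /h /l; field; lra.
  - move=> s t s0 t0 st; have := BK _ _ s0 t0 st; rewrite /B /h => e.
    have -> : G (s + t) = K * s * t + G s + G t by rewrite -e; ring.
    by field.
exists (K / 2); exists (l - K * a); exists (g a + K / 2 * a ^+ 2 - l * a).
move=> x xab.
have := h0 (x - a); rewrite /h /G (addrC a) subrK => e.
have {}e : g x - g a - K / 2 * (x - a) ^+ 2 - l * (x - a) = 0.
  by apply: e; rewrite /L; lra.
have -> : g x = g a + K / 2 * (x - a) ^+ 2 + l * (x - a) by lra.
by field.
Qed.

(* Iterating the translation gives affine differences for all multiples of
   [tau], and these multiples approximate every [d] as [tau] tends to 0. *)
Lemma affine_differences_interior (R : realType) (a b : R) (g : R -> R) :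
  continuous g ->
  (forall e, 0 < e -> exists tau c k : R, [/\ 0 < tau, tau < e &
     forall z, a + e <= z -> z + tau <= b - e ->
       g (z + tau) - g z = c * z + k]) ->
  forall e x y z d, 0 < e -> 0 <= d -> a + e <= x -> a + e <= y -> a + e <= z ->
    x + d <= b - e -> y + d <= b - e -> z + d <= b - e ->
    (z - x) * (g (y + d) - g y) =
    (z - y) * (g (x + d) - g x) + (y - x) * (g (z + d) - g z).
Proof.
move=> cg H e x y z d e0 d0 ax ay az xb yb zb.
pose F d := (z - x) * (g (y + d) - g y) -
    ((z - y) * (g (x + d) - g x) + (y - x) * (g (z + d) - g z)).
have cD w : {for d, continuous (fun d => g (w + d) - g w)}.
  apply: cvgB; last exact: cvg_cst.
  apply: (@continuous_comp _ _ _ (fun t => w + t) g); last exact: cg.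
  by apply: cvgD; [exact: cvg_cst|exact: cvg_id].
apply/eqP; rewrite -subr_eq0; apply/eqP.
apply: (@eq0_approx _ F).
  apply: cvgB; first by apply: cvgM; [exact: cvg_cst|exact: cD].
  by apply: cvgD; (apply: cvgM; [exact: cvg_cst|exact: cD]).
move=> e' e'0.
have [|tau [c [k [tau0 taue gtau]]]] := H (Num.min e e').
  by rewrite lt_min e0.
move: taue; rewrite lt_min => /andP[taue taue'].
have {}gtau w : a + e <= w -> w + tau <= b - e -> g (w + tau) - g w = c * w + k.
  have ee : Num.min e e' <= e by rewrite ge_min lexx.
  by move=> aw wb; apply: gtau; lra.
have gn n : exists c' k', forall w, a + e <= w -> w + tau * n%:R <= b - e ->
    g (w + tau * n%:R) - g w = c' * w + k'.
  elim: n => [|n [c' [k' IH]]].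
    by exists 0, 0 => w _ _; rewrite mulr0 addr0; ring.
  exists (c' + c), (k' + c * (tau * n%:R) + k) => w aw.
  rewrite -natr1 mulrDr mulr1 addrA => wb.
  have tn : 0 <= tau * n%:R by rewrite mulr_ge0 // ltW.
  have e1 := IH w aw ltac:(lra).
  have e2 := gtau (w + tau * n%:R) ltac:(lra) wb.
  have -> : g (w + tau * n%:R + tau) - g w =
    (g (w + tau * n%:R + tau) - g (w + tau * n%:R)) + (g (w + tau * n%:R) - g w).
    by ring.
  by rewrite e1 e2; ring.
(* Rounding [d / tau] down keeps [tau * n%:R <= d], so the shifted points do not leave the interior
   window. *)
have dt0 : 0 <= d / tau by rewrite divr_ge0 // ltW.
have /andP[] := truncn_itv dt0; set n := Num.truncn _.
rewrite ler_pdivlMr // ltr_pdivrMr // -natr1 mulrDl mul1r ![_ * tau]mulrC => n1 n2.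
exists (tau * n%:R); first by rewrite ger0_norm; lra.
have [c' [k' gk]] := gn n.
by rewrite /F !gk; first (by ring); lra.
Qed.

(** The interior identity is applied to points shrunk towards the midpoint, and continuity lets the
    shrinking tend to 0. *)
Lemma affine_differences (R : realType) (a b : R) (g : R -> R) :
  a < b -> continuous g ->
  (forall e, 0 < e -> exists tau c k : R, [/\ 0 < tau, tau < e &
     forall z, a + e <= z -> z + tau <= b - e ->
       g (z + tau) - g z = c * z + k]) ->
  forall x y z d, 0 <= d -> a <= x -> a <= y -> a <= z ->
     x + d <= b -> y + d <= b -> z + d <= b ->
    (z - x) * (g (y + d) - g y) =
    (z - y) * (g (x + d) - g x) + (y - x) * (g (z + d) - g z).
Proof.
move=> ab cg H x y z d d0 ax ay az xb yb zb.
pose m := (a + b) / 2.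
(* homothety of ratio [1 - s] centred at the midpoint, pushing into ]a, b[ *)
pose p s w := w + s * (m - w).
pose F s := (z - x) * (g (p s (y + d)) - g (p s y)) -
    ((z - y) * (g (p s (x + d)) - g (p s x)) +
     (y - x) * (g (p s (z + d)) - g (p s z))).
have cD w w' : {for 0, continuous (fun s => g (p s w) - g (p s w'))}.
  have cp v : {for 0, continuous (fun s => g (p s v))}.
    apply: (@continuous_comp _ _ _ (fun s => p s v) g); last exact: cg.
    apply: cvgD; first exact: cvg_cst.
    by apply: cvgM; [exact: cvg_id|exact: cvg_cst].
  by apply: cvgB; exact: cp.
have F00 : F 0 = 0; last first.
  apply/eqP; rewrite -subr_eq0; apply/eqP.
  by rewrite -[RHS]F00 /F /p !mul0r !addr0.
apply: (@eq0_approx _ F).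
  apply: cvgB; first by apply: cvgM; [exact: cvg_cst|exact: cD].
  by apply: cvgD; (apply: cvgM; [exact: cvg_cst|exact: cD]).
move=> e e0.
pose s := Num.min (1 / 2) (e / 2).
have s0 : 0 < s by rewrite lt_min; apply/andP; split; lra.
have [s1 se] : s <= 1 / 2 /\ s <= e / 2 by rewrite /s !ge_min !lexx orbT.
exists s; first by rewrite sub0r normrN gtr0_norm //; lra.
have q0 : 0 < s * (b - a) / 2 by rewrite divr_gt0 // mulr_gt0 // subr_gt0.
have pD w : p s (w + d) = p s w + (1 - s) * d by rewrite /p; ring.
have pa w : a <= w -> a + s * (b - a) / 2 <= p s w.
  move=> aw; rewrite -subr_ge0.
  have -> : p s w - (a + s * (b - a) / 2) = (1 - s) * (w - a) by rewrite /p /m; field.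
  by rewrite mulr_ge0 //; lra.
have pb w : w + d <= b -> p s w + (1 - s) * d <= b - s * (b - a) / 2.
  move=> wb; rewrite -pD -subr_ge0.
  have -> : b - s * (b - a) / 2 - p s (w + d) = (1 - s) * (b - (w + d)).
    by rewrite /p /m; field.
  by rewrite mulr_ge0 //; lra.
have sd : 0 <= (1 - s) * d by rewrite mulr_ge0 //; lra.
have := affine_differences_interior cg H q0 sd (pa x ax) (pa y ay) (pa z az)
  (pb x xb) (pb y yb) (pb z zb).
(* The identity is homogeneous in [x], [y], [z], so the factor [1 - s] cancels. *)
have pB u v : p s u - p s v = (1 - s) * (u - v) by rewrite /p; ring.
rewrite -!pD !pB => /eqP; rewrite -subr_eq0 => /eqP E.
have s1' : 1 - s != 0 by lra.
by apply: (mulfI s1'); rewrite mulr0 -[RHS]E /F; ring.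
Qed.

(** * Skew-affine symmetries of the graph *)

(* [u] lifts to a skew-affine map of the plane preserving the graph of [f]
   as long as abscissas stay in [[a, b]]. *)
Definition local_symmetry (R : realType) (a b : R) (f u : R -> R) :=
  exists q r s, forall x, a <= x <= b -> a <= u x <= b ->
    f (u x) = q * f x + r * x + s.

Section AffineFractal.
Variables (R : realType) (m : nat) (S : 'I_m -> skew_affine R).
Variables (a b : R) (f : R -> R).
Hypothesis ab : a < b.
Hypothesis hf : affine_fractal_function S a b f.

Let proj i := projection (S i).

Lemma sa_p_neq0 i : sa_p (S i) != 0. Proof. by case: hf => /(_ i)[]. Qed.

Lemma sa_q_neq0 i : sa_q (S i) != 0. Proof. by case: hf => /(_ i)[]. Qed.

Lemma skew_map_graph i x : a <= x <= b -> a <= proj i x <= b /\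
  f (proj i x) = sa_q (S i) * f x + sa_r (S i) * x + sa_s (S i).
Proof.
move=> xab; have [_ [[_ _ GE] _]] := hf.
have : graph_on a b f (skew_map (S i) (x, f x)).
  by rewrite GE; exists i => //; exists (x, f x).
by case.
Qed.

Lemma projection_surj x : a <= x <= b ->
  exists i y, a <= y <= b /\ x = proj i y.
Proof.
move=> xab; have [_ [[_ _ GE] _]] := hf.
have : graph_on a b f (x, f x) by [].
rewrite GE => -[i _ [[y w] [/= yab _] [<- _]]].
by exists i, y.
Qed.

(** A point of [[a, b]] farthest from [x0] is the image of a point no farther away under a
    contraction about [x0], so it equals [x0]. The farther endpoint is such a point, whence
    [a = b]. *)
Lemma no_common_fixpoint x0 :
  ~ (forall i, sa_p (S i) * x0 + sa_h (S i) = x0).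
Proof.
move=> fix0.
have farthest x : a <= x <= b ->
    (forall y, a <= y <= b -> `|y - x0| <= `|x - x0|) -> x = x0.
  move=> xab xmax; have [i [y [yab xy]]] := projection_surj xab.
  have [_ p1 _ _] : admissible (S i) by case: hf.
  apply/eqP; rewrite -subr_eq0 -normr_le0.
  have e : x - x0 = sa_p (S i) * (y - x0).
    by rewrite xy -[in LHS](fix0 i) /proj /projection /line_map /=; ring.
  have := xmax _ yab; move: (congr1 Num.norm e); rewrite normrM => {}e yx.
  have : `|x - x0| <= `|sa_p (S i)| * `|x - x0| by rewrite e ler_wpM2l // -e.
  apply: contraTT; rewrite -!ltNge => x0'.
  by rewrite gtr_pMl.
have Na : - (a - x0) <= `|a - x0| by rewrite -normrN ler_norm.
have Nb : b - x0 <= `|b - x0| by rewrite ler_norm.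
have [ba|/ltW ba] := leP `|b - x0| `|a - x0|.
  have ax0 : a = x0.
    apply: farthest => [|y yab]; first by rewrite lexx ltW.
    by rewrite ler_norml; lra.
  by move: ba; rewrite ax0 subrr normr0 normr_le0 subr_eq0 => /eqP bx0; move: ab; rewrite ax0 bx0 ltxx.
have bx0 : b = x0.
  apply: farthest => [|y yab]; first by rewrite lexx ltW.
  by rewrite ler_norml; lra.
by move: ba; rewrite bx0 subrr normr0 normr_le0 subr_eq0 => /eqP ax0; move: ab; rewrite ax0 bx0 ltxx.
Qed.

Lemma semigroup_gen_symmetry u : semigroup_gen proj u ->
  (forall x, a <= x <= b -> a <= u x <= b) /\
  exists p h q r s, q != 0 /\ forall x, u x = p * x + h /\
    (a <= x <= b -> f (u x) = q * f x + r * x + s).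
Proof.
elim=> [i|v w _ [vab [p [h [q [r [s [q0 vE]]]]]]]
          _ [wab [p' [h' [q' [r' [s' [q'0 wE]]]]]]]].
  split=> [x /(skew_map_graph i)[]//|].
  exists (sa_p (S i)), (sa_h (S i)), (sa_q (S i)), (sa_r (S i)), (sa_s (S i)).
  by split=> [|x]; [exact: sa_q_neq0|split=> // /(skew_map_graph i)[]].
split=> [x /wab /vab//|].
exists (p * p'), (p * h' + h), (q * q'), (q * r' + r * p'),
  (q * s' + r * h' + s).
split=> [|x]; first by rewrite mulf_neq0.
have [wx fwx] := wE x; have [vwx fvwx] := vE (w x).
split=> [|xab /=]; first by rewrite /= vwx wx; ring.
by rewrite fvwx ?fwx ?wab // wx; ring.
Qed.

(** With [y = v (u2 x)], [f (u2 x) = f (u1 y)] is expanded by the lifts of [u2] and [u1] and solved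
    for [f y], as [q1] is nonzero. The lift of [u1] applies only when [y] lies in [[a, b]], hence
    the local notion. *)
Lemma associated_family_symmetry u :
  associated_family (semigroup_gen proj) u -> local_symmetry a b f u.
Proof.
move=> [u1 [u2 [v [/semigroup_gen_symmetry[_ [p1 [h1 [q1 [r1 [s1 [q10 u1E]]]]]]]
  /semigroup_gen_symmetry[_ [p2 [h2 [q2 [r2 [s2 [_ u2E]]]]]]] u1K vK ->]]]].
have [c [k vE]] : exists c k, forall x, v x = c * x + k.
  have p10 : p1 != 0.
    apply/eqP => p10; have /eqP : (0 : R) = 1.
      by rewrite -(u1K 0) -(u1K 1) !(u1E _).1 p10 !mul0r.
    by rewrite eq_sym oner_eq0.
  exists p1^-1, (- h1 / p1) => x; apply: (can_inj u1K).
  by rewrite vK (u1E _).1; field.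
exists (q2 / q1), ((r2 - r1 * c * p2) / q1),
  ((s2 - r1 * (c * h2 + k) - s1) / q1) => x xab /= yab.
have := (u1E (v (u2 x))).2 yab; rewrite vK (u2E x).2 // vE (u2E x).1 => e.
by apply: (mulfI q10); rewrite [LHS](_ : _ = q2 * f x + r2 * x + s2 -
  r1 * (c * (p2 * x + h2) + k) - s1); [field|rewrite e; ring].
Qed.

(* The conjugate of [t] by [S i] has the same linear part and the same
   vertical ratio [q] as [t], so composing it with the inverse of [t]
   leaves a horizontal translation whose lift has vertical ratio 1. *)
Lemma symmetry_conjugate_translation p h i : p != 0 ->
  local_symmetry a b f (line_map (p, h)) ->
  let tau := ((p - 1) * sa_h (S i) + (1 - sa_p (S i)) * h) / sa_p (S i) in
  exists c k, forall z, a <= z <= b -> a <= z + tau <= b ->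
    a <= (z - h) / p <= b -> f (z + tau) - f z = c * z + k.
Proof.
move=> p0 [q [r [s tE]]] tau.
have P0 := sa_p_neq0 i; have Q0 := sa_q_neq0 i.
have [P Pdef] : exists P, P = sa_p (S i) by eexists.
have [H Hdef] : exists H, H = sa_h (S i) by eexists.
have [Q Qdef] : exists Q, Q = sa_q (S i) by eexists.
have [r' r'def] : exists r', r' = sa_r (S i) by eexists.
have [s' s'def] : exists s', s' = sa_s (S i) by eexists.
have gE x : a <= x <= b -> a <= P * x + H <= b /\
    f (P * x + H) = Q * f x + r' * x + s'.
  by move/(skew_map_graph i); rewrite /proj /projection /line_map /=
     -Pdef -Hdef -Qdef -r'def -s'def.
have {P0 Q0} [P0 Q0] : P != 0 /\ Q != 0 by rewrite Pdef Qdef.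
rewrite {}/tau.
have [tau tauE ->] : exists2 tau, P * tau = (p - 1) * H + (1 - P) * h &
    ((p - 1) * sa_h (S i) + (1 - sa_p (S i)) * h) / sa_p (S i) = tau.
  by rewrite -Pdef -Hdef; eexists; last reflexivity; field.
(* [al] is the coefficient of [x = (z - h) / p] in [f (z + tau) - f z]. *)
pose al := (q * r' + r * P) / Q - r.
exists (al / p - r' / Q),
  ((q * s' + r * H + s - s' - r' * tau) / Q - s - al * h / p).
move=> z zab yab xab.
have [x xE] : exists x, x = (z - h) / p by eexists.
rewrite -xE in xab.
have zE : z = p * x + h by rewrite xE; field.
have tx := tE _ xab; rewrite /line_map /= -zE in tx.
have [yab' fy] := gE _ yab.
have [xab' fx] := gE _ xab.
(* With [t] the map [line_map (p, h)] and [z = t x], this says that [S i] sends [z + tau] to [t] of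
   the image of [x]. Evaluating [f] there both ways eliminates [f x]. *)
have yE : P * (z + tau) + H = p * (P * x + H) + h by rewrite mulrDr tauE zE; ring.
have := tE _ xab'; rewrite /line_map /= -yE => /(_ yab').
rewrite fy fx (tx zab) => e.
apply: (mulfI Q0).
have -> : Q * (f (z + tau) - (q * f x + r * x + s)) =
  (Q * f (z + tau) + r' * (z + tau) + s') - r' * (z + tau) - s' -
  Q * (q * f x + r * x + s) by ring.
by rewrite e /al zE; field; rewrite p0 Q0.
Qed.

(** * Small translations when weak separation fails *)

Lemma small_translations :
  ~ line_wsp proj ->
  forall e, 0 < e -> exists tau c k : R, [/\ 0 < tau, tau < e &
     forall z, a + e <= z -> z + tau <= b - e ->
       f (z + tau) - f z = c * z + k].
Proof.
move=> nwsp e e0.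
(* For [(p, h)] within [d] of [(1, 0)], the translation from [S i] has size at most [d * M i]. In
   [N], the terms in [a] and [b] control the displacement of [z] to [(z - h) / p]. *)
pose M i := (`|sa_h (S i)| + 1 + `|sa_p (S i)|) / `|sa_p (S i)|.
have M0 i : 0 <= M i by rewrite divr_ge0 // !addr_ge0.
pose N := 1 + `|a| + `|b| + \sum_i M i.
have sM0 : 0 <= \sum_i M i by apply: sumr_ge0.
have [a0 b0] := (normr_ge0 a, normr_ge0 b).
have N0 : 0 < N by rewrite /N; lra.
pose d := Num.min (1 / 2) (e / N).
have d0 : 0 < d by rewrite lt_min divr_gt0 //= divr_gt0.
have d2 : d <= 1 / 2 by rewrite /d ge_min lexx.
have dN : d * N <= e by rewrite -ler_pdivlMr // /d ge_min lexx orbT.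
(* [isolated] includes membership, so its failure gives nearby elements only once the identity is
   known to be in the family. *)
have idF : associated_family (semigroup_gen proj) (line_map (1, 0)).
  have [i [_ _]] : exists i y, a <= y <= b /\ a = proj i y.
    by apply: projection_surj; rewrite lexx ltW.
  have P0 := sa_p_neq0 i.
  exists (proj i), (proj i), (fun x => (x - sa_h (S i)) / sa_p (S i)).
  split; [exact: semigroup_gen_base|exact: semigroup_gen_base| | |].
  - by move=> x; rewrite /proj /projection /line_map /=; field.
  - by move=> x; rewrite /proj /projection /line_map /=; field.
  - by apply/funext => x; rewrite /proj /projection /line_map /=; field.
have [p [h [cF cn1 p1 h0]]] : exists p h,
    [/\ associated_family (semigroup_gen proj) (line_map (p, h)),
      (p, h) <> (1, 0), `|p - 1| < d & `|h| < d].
  apply: contrapT => nex; apply: nwsp; split; first exact/mem_set.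
  exists (ball ((1, 0) : R * R) d); first exact: nbhsx_ballx.
  apply/seteqP; split=> [[p h] [[/= p1 h0] cF]|_ -> /=].
    apply: contrapT => cn1; apply: nex; exists p, h; split => //.
      by rewrite distrC.
    by move: h0; rewrite /ball /= sub0r normrN.
  by split; first exact: ballxx.
have /andP[p1l p1r] : - d < p - 1 < d by rewrite -ltr_norml.
have /andP[h0l h0r] : - d < h < d by rewrite -ltr_norml.
have p0 : 0 < p by lra.
pose tau i := ((p - 1) * sa_h (S i) + (1 - sa_p (S i)) * h) / sa_p (S i).
(* [tau i = 0] means that [line_map (p, h)] commutes with [proj i]. If this holds for all [i],
   either [p = 1] and then [h = 0], or the fixed point [h / (1 - p)] is common to all [proj i]. *)
have [i taui0] : exists i, tau i != 0.
  apply: contrapT => ntau.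
  have tau0 i : (p - 1) * sa_h (S i) + (1 - sa_p (S i)) * h = 0.
    have P0 := sa_p_neq0 i.
    apply: (mulIf (invr_neq0 P0)); rewrite mul0r.
    by apply/eqP; apply: contrapT => /negP t0; apply: ntau; exists i.
  have [p1e|pn1] := eqVneq p 1.
    have [i [_ _]] : exists i y, a <= y <= b /\ a = proj i y.
      by apply: projection_surj; rewrite lexx ltW.
    have [_ P1 _ _] : admissible (S i) by case: hf.
    have := tau0 i; rewrite p1e subrr mul0r add0r => /eqP.
    rewrite mulf_eq0 subr_eq0 => /orP[/eqP P1'|/eqP h00].
      by move: P1; rewrite -P1' normr1 ltxx.
    by apply: cn1; rewrite p1e h00.
  have pn : p - 1 != 0 by rewrite subr_eq0.
  apply: (@no_common_fixpoint (h / (1 - p))) => i.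
  have pn' : 1 - p != 0 by rewrite -opprB oppr_eq0.
  apply: (mulfI pn); have -> : (p - 1) * (sa_p (S i) * (h / (1 - p)) + sa_h (S i)) =
    ((p - 1) * sa_h (S i) + (1 - sa_p (S i)) * h) - h by field.
  by rewrite tau0; field.
have P0 := sa_p_neq0 i.
have taue : `|tau i| < e.
  have Mi : M i <= \sum_j M j.
    by rewrite (bigD1 i) //= lerDl sumr_ge0.
  have : `|tau i| <= d * M i.
    rewrite /tau normrM normfV /M mulrA ler_wpM2r ?invr_ge0 //.
    apply: le_trans (ler_normD _ _) _; rewrite !normrM.
    have H1 : `|p - 1| * `|sa_h (S i)| <= d * `|sa_h (S i)|.
      by rewrite ler_wpM2r // ltW.
    have : `|1 - sa_p (S i)| * `|h| <= (1 + `|sa_p (S i)|) * d.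
      apply: ler_pM => //; last exact: ltW.
      by apply: le_trans (ler_normB _ _) _; rewrite normr1.
    lra.
  have : d * M i <= d * \sum_j M j by rewrite ler_wpM2l // ltW.
  move: dN; rewrite /N !mulrDr mulr1.
  have := mulr_ge0 (ltW d0) a0; have := mulr_ge0 (ltW d0) b0; lra.
have da : d * (1 + `|a|) <= e.
  apply: le_trans dN; rewrite ler_wpM2l ?(ltW d0) // /N; lra.
have db : d * (1 + `|b|) <= e.
  apply: le_trans dN; rewrite ler_wpM2l ?(ltW d0) // /N; lra.
have inside z : a + e <= z -> z <= b - e -> a <= (z - h) / p <= b.
  move=> az zb; rewrite ler_pdivlMr // ler_pdivrMr //.
  have : `|a * (p - 1)| <= `|a| * d by rewrite normrM ler_wpM2l // ltW.
  have : `|b * (p - 1)| <= `|b| * d by rewrite normrM ler_wpM2l // ltW.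
  by rewrite !ler_norml; lra.
have [c [k ftau]] := symmetry_conjugate_translation i (lt0r_neq0 p0)
  (associated_family_symmetry cF).
rewrite -/(tau i) in ftau.
(* A negative [tau i] is replaced by its opposite, with the relation read at [z - tau i]. *)
move: taui0 taue; rewrite neq_lt => /orP[tneg|tpos].
  rewrite ltr0_norm // => taue.
  exists (- tau i), (- c), (c * tau i - k); split => //; first by rewrite oppr_gt0.
  move=> z az zb; have := ftau (z - tau i); rewrite subrK => H.
  have := H ltac:(lra) ltac:(lra) ltac:(apply: inside; lra); lra.
rewrite gtr0_norm // => taue.
exists (tau i), c, k; split => // z az zb.
by apply: ftau; [lra|lra|apply: inside; lra].
Qed.

End AffineFractal.

Theorem theorem3 (R : realType) (m : nat) (S : 'I_m -> skew_affine R)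
    (a b : R) (hab : a < b) (f : R -> R)
    (hf : affine_fractal_function S a b f)
    (hwsp : ~ line_wsp (fun i => projection (S i))) :
  parabola_segment (graph_on a b f).
Proof.
have [_ [[_ cG _] _]] := hf.
have cg := compact_graph_continuous (ltW hab) cG.
set g := f \o clamp a b in cg.
have gE x : a <= x <= b -> g x = f x by rewrite /g /= => /clamp_id ->.
have small e : 0 < e -> exists tau c k : R, [/\ 0 < tau, tau < e &
    forall z, a + e <= z -> z + tau <= b - e -> g (z + tau) - g z = c * z + k].
  move=> e0; have [tau [c [k [t0 te H]]]] := small_translations hab hf hwsp e0.
  by exists tau, c, k; split => // z az zb; rewrite !gE ?H //; lra.
have [k [l [n gQ]]] :=
  quadratic_of_affine_differences hab cg (affine_differences hab cg small).
exists a, b, k, l, n; split => //.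
by apply/seteqP; split=> -[x y] [/= xab ->]; split=> //=; rewrite -?gQ ?gE.
Qed.
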